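(* Let $\vdash$ be a logic and $\mathsf{M}$ a class of matrices containing the trivial matrix $\langle\mathbf{1},\{1\}\rangle$ (where $\mathbf{1}$ is the one-element algebra). If $\vdash$ is complete with respect to $\mathsf{M}$, then the left variable inclusion companion $\vdash^{l}$ is complete with respect to $\mathrm{PL}(\mathsf{M})$.
   Context: Fix an algebraic language without constant symbols; $\mathbf{Fm}$ is the algebra of formulas over a countably infinite set of variables, $\mathrm{Var}(\varphi)$ the set of variables occurring in $\varphi$, $\mathrm{Var}(\Gamma)=\bigcup_{\gamma\in\Gamma}\mathrm{Var}(\gamma)$. A logic is a substitution-invariant consequence relation $\vdash\subseteq\mathcal{P}(Fm)\times Fm$. A matrix is a pair $\langle\mathbf{A},F\rangle$ with $F\subseteq A$. A class of matrices $\mathsf{M}$ induces the logic $\vdash_{\mathsf{M}}$: $\Gamma\vdash_{\mathsf{M}}\varphi$ iff for every $\langle\mathbf{A},F\rangle\in\mathsf{M}$ and homomorphism $h\colon\mathbf{Fm}\to\mathbf{A}$, $h[\Gamma]\subseteq F$ implies $h(\varphi)\in F$; $\vdash$ is complete w.r.t. $\mathsf{M}$ if $\vdash=\vdash_{\mathsf{M}}$. The left variable inclusion companion: $\Gamma\vdash^{l}\varphi$ iff there is $\Gamma'\subseteq\Gamma$ with $\mathrm{Var}(\Gamma')\subseteq\mathrm{Var}(\varphi)$ and $\Gamma'\vdash\varphi$. A directed system of matrices consists of a semilattice $\langle I,\vee\rangle$ (ordered by $i\le j$ iff $i\vee j=j$), matrices $\langle\mathbf{A}_i,F_i\rangle$,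 $i\in I$, with pairwise disjoint universes, and homomorphisms $f_{ij}\colon\mathbf{A}_i\to\mathbf{A}_j$ for $i\le j$ with $f_{ij}[F_i]\subseteq F_j$, $f_{ii}$ the identity, $f_{ik}=f_{jk}\circ f_{ij}$ for $i\le j\le k$. Its Płonka sum is $\langle\mathbf{A},\bigcup_i F_i\rangle$, where $\mathbf{A}$ has universe $\bigcup_i A_i$ and for each $n$-ary basic operation $f$ and $a_1\in A_{i_1},\dots,a_n\in A_{i_n}$, $f^{\mathbf{A}}(a_1,\dots,a_n)=f^{\mathbf{A}_j}(f_{i_1j}(a_1),\dots,f_{i_nj}(a_n))$ with $j=i_1\vee\dots\vee i_n$. $\mathrm{PL}(\mathsf{M})$ denotes the class of Płonka sums of directed systems of matrices belonging to $\mathsf{M}$. *)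

(* Defs.v *)
From mathcomp Require Import all_boot all_order.
From mathcomp Require Import classical_sets.

Set Implicit Arguments.
Unset Strict Implicit.
Unset Printing Implicit Defensive.

Local Open Scope order_scope.
Local Open Scope classical_set_scope.

Record language := Language {
  op : Type;
  arity : op -> nat;
  arity_gt0 : forall o, (0 < arity o)%N
}.

(* The algebras of universal algebra are nonempty. *)
Record algebra (L : language) := Algebra {
  car :> Type;
  interp : forall o : op L, {ffun 'I_(arity o) -> car} -> car;
  car_inhabited : inhabited car
}.

Definition is_hom (L : language) (A B : algebra L) (f : A -> B) : Prop :=
  forall (o : op L) (x : {ffun 'I_(arity o) -> A}),
    f (interp x) = interp [ffun k => f (x k)].

Inductive fm (L : language) : Type :=
| FVar (v : nat)
| FApp (o : op L) (x : {ffun 'I_(arity o) -> fm L}).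

Arguments FVar {L} v.
Arguments FApp {L} o x.

Definition Fm (L : language) : algebra L :=
  Algebra (@FApp L) (inhabits (FVar 0)).

Fixpoint Var (L : language) (phi : fm L) : set nat :=
  match phi with
  | FVar v => [set v]
  | FApp o x => [set v | exists k : 'I_(arity o), Var (x k) v]
  end.

Definition VarS (L : language) (Gamma : set (Fm L)) : set nat :=
  \bigcup_(gamma in Gamma) Var gamma.

Record logic (L : language) := Logic {
  entails :> set (Fm L) -> Fm L -> Prop;
  entails_refl : forall (Gamma : set (Fm L)) phi,
    Gamma phi -> entails Gamma phi;
  entails_trans : forall (Gamma Delta : set (Fm L)) phi,
    (forall delta, Delta delta -> entails Gamma delta) ->
    entails Delta phi -> entails Gamma phi;
  entails_subst : forall (sigma : Fm L -> Fm L) (Gamma : set (Fm L)) phi,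
    is_hom sigma -> entails Gamma phi -> entails (sigma @` Gamma) (sigma phi)
}.

Record lmatrix (L : language) := LMatrix {
  malg :> algebra L;
  filt : set malg
}.

Arguments filt {L} l.

(* <1, {1}>, characterized up to isomorphism. *)
Definition is_trivial_matrix (L : language) (X : lmatrix L) : Prop :=
  exists2 e : X, (forall x : X, x = e) & filt X e.

Definition matrix_entails (L : language) (M : lmatrix L -> Prop)
    (Gamma : set (Fm L)) (phi : Fm L) : Prop :=
  forall X : lmatrix L, M X ->
  forall h : Fm L -> X, is_hom h ->
    h @` Gamma `<=` filt X -> filt X (h phi).

Definition complete_wrt (L : language)
    (vd : set (Fm L) -> Fm L -> Prop) (M : lmatrix L -> Prop) : Prop :=
  forall Gamma phi, vd Gamma phi <-> matrix_entails M Gamma phi.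

Definition left_companion (L : language) (vd : set (Fm L) -> Fm L -> Prop)
    (Gamma : set (Fm L)) (phi : Fm L) : Prop :=
  exists Gamma' : set (Fm L),
    [/\ Gamma' `<=` Gamma, VarS Gamma' `<=` Var phi & vd Gamma' phi].

(* Disjointness of the universes is not a field: the Plonka sum below is formed
   on the tagged union {i : I & fam i}, in which the fibres are disjoint.  In a
   joinSemilatticeType, i <= j is equivalent to i `|` j = j (lemma leEjoin). *)
Record directed_system (L : language) d (I : joinSemilatticeType d) :=
  DirectedSystem {
  fam :> I -> lmatrix L;
  trans : forall i j : I, i <= j -> fam i -> fam j;
  index_inhabited : inhabited I;
  trans_hom : forall (i j : I) (ij : i <= j), is_hom (trans ij);
  trans_filter : forall (i j : I) (ij : i <= j),
    trans ij @` filt (fam i) `<=` filt (fam j);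
  trans_id : forall (i : I) (ii : i <= i) (a : fam i), trans ii a = a;
  trans_comp : forall (i j k : I) (ij : i <= j) (jk : j <= k) (ik : i <= k)
    (a : fam i), trans ik a = trans jk (trans ij a)
}.

Section PlonkaSum.
Variables (L : language) (d : Order.disp_t) (I : joinSemilatticeType d).
Variable D : directed_system L I.

Definition plonka_car : Type := {i : I & D i}.

(* i_1 v ... v i_n for n >= 1.  I need not have a bottom element, so the
   iterated join starts from the first index, which idempotence absorbs. *)
Definition index_join (n : nat) (n_gt0 : (0 < n)%N) (i : 'I_n -> I) : I :=
  \big[Order.join/i (Ordinal n_gt0)]_(k < n) i k.

Lemma index_join_ub (n : nat) (n_gt0 : (0 < n)%N) (i : 'I_n -> I) (k : 'I_n) :
  i k <= index_join n_gt0 i.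
Proof.
rewrite /index_join; move: (i (Ordinal n_gt0)) => i0.
have: k \in index_enum 'I_n by rewrite mem_index_enum.
elim: (index_enum _) => [//|l s IHs]; rewrite inE big_cons => /predU1P[-> | ks].
  exact: Order.JoinTheory.leUl.
exact/(Order.POrderTheory.le_trans (IHs ks))/Order.JoinTheory.leUr.
Qed.

Definition plonka_interp (o : op L) (x : {ffun 'I_(arity o) -> plonka_car}) :
    plonka_car :=
  let i := fun k : 'I_(arity o) => projT1 (x k) in
  let j := index_join (arity_gt0 o) i in
  existT (fun i : I => D i : Type) j (interp
    [ffun k => trans (index_join_ub (arity_gt0 o) i k) (projT2 (x k))]).

Lemma plonka_inhabited : inhabited plonka_car.
Proof.
by case: (index_inhabited D) => i; case: (car_inhabited (D i)) => a; exists; exists i.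
Qed.

Definition plonka_algebra : algebra L :=
  Algebra plonka_interp plonka_inhabited.

Definition plonka_sum : lmatrix L :=
  @LMatrix L plonka_algebra
    [set a : plonka_car | filt (D (projT1 a)) (projT2 a)].

End PlonkaSum.

Inductive PL (L : language) (M : lmatrix L -> Prop) : lmatrix L -> Prop :=
| PL_sum d (I : joinSemilatticeType d) (D : directed_system L I) :
    (forall i : I, M (D i)) -> PL M (plonka_sum D).

(* Main.v *)
(** Soundness.  Given [h] into a Plonka sum, let [j] be the index of [h phi].
    Every [h psi] with [Var psi] included in [Var phi] lies in a fibre below
    [j], and pushing such elements forward to the fibre [j] is a homomorphism;
    it thus reduces a valuation in the sum to a valuation in a matrix of [M].

    Completeness.  Given [g] into a matrix [X] of [M], adjoin a trivial matrix
    on top of [X] (a system indexed by [false < true]), and send a formula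
    [psi] to [g psi] when [Var psi] is included in [Var phi] and to the trivial
    point otherwise: the premises with extra variables hold automatically, so
    only those with variables in [Var phi] can be needed. *)
Require Import Defs.
From mathcomp Require Import all_boot all_order.
From mathcomp Require Import boolp classical_sets.

Set Implicit Arguments.
Unset Strict Implicit.
Unset Printing Implicit Defensive.

Import Order.Theory.

(** The arguments of [FApp] are nested inside a finite function; a direct [fix] reaches each
    subformula [x k] as a structurally smaller term. *)
Lemma fm_ffun_ind (L : language) (P : fm L -> Prop) :
  (forall v, P (FVar v)) ->
  (forall o (x : {ffun 'I_(arity o) -> fm L}),
    (forall k, P (x k)) -> P (FApp o x)) ->
  forall psi, P psi.
Proof.
move=> PV PA; fix IH 1 => -[v|o x]; first exact: PV.
by apply: PA => k; apply: IH.
Qed.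

Fixpoint fm_eval (L : language) (A : algebra L) (rho : nat -> A) (psi : fm L) : A :=
  match psi with
  | FVar v => rho v
  | FApp o x => interp [ffun k => fm_eval rho (x k)]
  end.

Lemma fm_eval_hom (L : language) (A : algebra L) (rho : nat -> A) :
  @is_hom L (Fm L) A (fm_eval rho).
Proof. by []. Qed.

Lemma Var_FApp_subset (L : language) (o : op L)
    (x : {ffun 'I_(arity o) -> fm L}) (S : set nat) :
  (Var (FApp o x) `<=` S)%classic <-> forall k, (Var (x k) `<=` S)%classic.
Proof.
split=> [sub k v xv|sub v [k xv]]; last exact: sub xv.
by apply: sub; exists k.
Qed.

Lemma index_join_lub d (I : joinSemilatticeType d) n (n_gt0 : (0 < n)%N)
    (i : 'I_n -> I) (j : I) :
  (forall k, (i k <= j)%O) -> (index_join n_gt0 i <= j)%O.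
Proof.
move=> le_ij; rewrite /index_join; elim/big_rec: _ => [//|k a _ le_aj].
by rewrite leUx le_ij.
Qed.

Section PlonkaSum.
Variables (L : language) (d : Order.disp_t) (I : joinSemilatticeType d).
Variable D : directed_system L I.

(* [b0] is a junk value, taken when the fibre of [a] is not below [j]. *)
Definition push (j : I) (b0 : D j) (a : plonka_car D) : D j :=
  match @idP (projT1 a <= j)%O with
  | ReflectT le => trans le (projT2 a)
  | ReflectF _ => b0
  end.

Lemma push_le j (b0 : D j) (a : plonka_car D) (le : (projT1 a <= j)%O) :
  push b0 a = trans le (projT2 a).
Proof.
rewrite /push; case: {-}_ / idP => [le'|/(_ le)//].
by rewrite (bool_irrelevance le' le).
Qed.

Lemma push_fibre j (b0 b : D j) : push b0 (existT _ j b) = b.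
Proof. by rewrite (push_le _ (lexx j : (projT1 (existT _ j b) <= j)%O)) trans_id. Qed.

(** This moves a point along a propositional equality of indices without an explicit cast. *)
Lemma existT_push j (b0 : D j) (a : plonka_car D) :
  projT1 a = j -> a = existT _ j (push b0 a).
Proof. by case: a => i a /= ij; case: j / ij b0 => b0; rewrite push_fibre. Qed.

(** The transition map from the join of the indices to [j] is a homomorphism, and composing it with
    the maps into the join gives the direct maps to [j]. *)
Lemma push_interp j (b0 : D j) (o : op L)
    (x : {ffun 'I_(arity o) -> plonka_car D}) :
  (forall k, (projT1 (x k) <= j)%O) ->
  push b0 (plonka_interp x) = interp [ffun k => push b0 (x k)].
Proof.
move=> le_xj.
have le : (projT1 (plonka_interp x) <= j)%O by apply: index_join_lub.
rewrite (push_le _ le) /= trans_hom; congr interp; apply/ffunP => k.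
by rewrite !ffunE (push_le _ (le_xj k)) -trans_comp.
Qed.

Lemma plonka_interp_fibre i (o : op L)
    (x : {ffun 'I_(arity o) -> plonka_car D}) (y : {ffun 'I_(arity o) -> D i}) :
  (forall k, x k = existT _ i (y k)) ->
  plonka_interp x = existT _ i (interp y).
Proof.
move=> xy; have le_xi k : (projT1 (x k) <= i)%O by rewrite xy.
have ij : projT1 (plonka_interp x) = i.
  apply: le_anti; rewrite index_join_lub //=.
  (* Positive arity provides an argument, whose index [i] bounds the join from below. *)
  have := index_join_ub (arity_gt0 o) (fun k => projT1 (x k))
    (Ordinal (arity_gt0 o)).
  by rewrite {1}xy.
rewrite (existT_push (interp y) ij) push_interp //.
suff -> : [ffun k => push (interp y) (x k)] = y by [].
by apply/ffunP => k; rewrite ffunE xy push_fibre.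
Qed.

Section Valuation.
Variable h : Fm L -> plonka_algebra D.
Hypothesis hh : is_hom h.

Let h_FApp o (x : {ffun 'I_(arity o) -> fm L}) :
  h (FApp o x) = plonka_interp [ffun k => h (x k)].
Proof. exact: hh. Qed.

Lemma le_index_subterm o (x : {ffun 'I_(arity o) -> fm L}) k :
  (projT1 (h (x k)) <= projT1 (h (FApp o x)))%O.
Proof.
rewrite h_FApp /=.
have := index_join_ub (arity_gt0 o)
  (fun k => projT1 ([ffun k => h (x k)] k)) k.
by rewrite {1}ffunE.
Qed.

Lemma le_index_Var psi v :
  Var psi v -> (projT1 (h (FVar v)) <= projT1 (h psi))%O.
Proof.
elim/fm_ffun_ind: psi => [w <- //|o x IH [k /IH le_v]].
exact: le_trans le_v (le_index_subterm x k).
Qed.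

(** With [le_index_Var], this makes the index of [h psi] the least upper bound of the indices of its
    variables, hence monotone in [Var psi]. *)
Lemma index_le_Var psi j :
  (forall v, Var psi v -> (projT1 (h (FVar v)) <= j)%O) ->
  (projT1 (h psi) <= j)%O.
Proof.
elim/fm_ffun_ind: psi => [w|o x IH] le_Vj; first exact: le_Vj.
rewrite h_FApp; apply: index_join_lub => k; rewrite ffunE.
by apply: IH => v xv; apply: le_Vj; exists k.
Qed.

(** Junk values may keep [push b0] after [h] from being a homomorphism, so it is compared with a
    genuine one only where the index is below [j]. *)
Lemma push_hom_eval j (b0 : D j) psi :
  (projT1 (h psi) <= j)%O ->
  push b0 (h psi) = fm_eval (fun v => push b0 (h (FVar v))) psi.
Proof.
elim/fm_ffun_ind: psi => [//|o x IH] le_j.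
have le_x k := le_trans (le_index_subterm x k) le_j.
rewrite h_FApp push_interp => [|k]; last by rewrite ffunE.
by congr interp; apply/ffunP => k; rewrite !ffunE IH.
Qed.

End Valuation.
End PlonkaSum.

Lemma push_filt (L : language) d (I : joinSemilatticeType d)
    (D : directed_system L I) j (b0 : D j) (a : plonka_sum D) :
  (projT1 a <= j)%O -> filt (plonka_sum D) a -> filt (D j) (push b0 a).
Proof.
move=> le Fa; rewrite (push_le _ le).
by apply: (trans_filter (ij := le)); exists (projT2 a).
Qed.

Lemma left_companion_sound (L : language) (vd : logic L) (M : lmatrix L -> Prop)
    Gamma phi :
  (forall Delta psi, vd Delta psi -> matrix_entails M Delta psi) ->
  left_companion vd Gamma phi -> matrix_entails (PL M) Gamma phi.
Proof.
move=> sound [G' [G'G VG' G'phi]] _ [d I D MD] h hh hG.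
set j := projT1 (h phi); pose b0 : D j := projT2 (h phi).
pose g := fm_eval (fun v => push b0 (h (FVar v))).
have le_j psi : (Var psi `<=` Var phi)%classic -> (projT1 (h psi) <= j)%O.
  by move=> sub; apply: index_le_Var => // v /sub; apply: le_index_Var.
have : filt (D j) (g phi).
  apply: (sound _ _ G'phi _ (MD j)); first exact: fm_eval_hom.
  move=> _ [gamma Ggamma <-].
  have le_gamma : (projT1 (h gamma) <= j)%O.
    by apply: le_j => v vg; apply: VG'; exists gamma.
  rewrite /g -push_hom_eval //; apply: push_filt => //.
  by apply: hG; exists gamma => //; apply: G'G.
rewrite /g -push_hom_eval // (push_le _ (lexx j : (projT1 (h phi) <= j)%O)).
by rewrite trans_id.
Qed.

Section TrivialTop.
Variables (L : language) (X T : lmatrix L) (e : T).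
Hypotheses (T_e : forall t : T, t = e) (filt_e : filt T e).

Definition top_fam (b : bool) : lmatrix L := if b then T else X.

(** The constant [e] also serves as the map from [T] to itself, where it is the identity because [T]
    has no other point. *)
Definition top_trans (i j : bool) : (i <= j)%O -> top_fam i -> top_fam j :=
  match i, j with
  | false, false => fun _ => id
  | true, false => fun le => False_rect _ (elimF idP (erefl : (true <= false)%O = false) le)
  | _, true => fun _ _ => e
  end.

Lemma top_trans_hom i j (ij : (i <= j)%O) : is_hom (top_trans ij).
Proof.
case: i j ij => -[] // ij o x; rewrite /= ?[RHS]T_e //.
by congr interp; apply/ffunP => k; rewrite ffunE.
Qed.

Lemma top_trans_filter i j (ij : (i <= j)%O) :
  (top_trans ij @` filt (top_fam i) `<=` filt (top_fam j))%classic.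
Proof. by case: i j ij => -[] // ij _ [a Fa <-]. Qed.

Lemma top_trans_id i (ii : (i <= i)%O) a : top_trans ii a = a.
Proof. by case: i ii a => //= _ a; rewrite [RHS]T_e. Qed.

Lemma top_trans_comp i j k (ij : (i <= j)%O) (jk : (j <= k)%O) (ik : (i <= k)%O)
  a : top_trans ik a = top_trans jk (top_trans ij a).
Proof. by case: i j k ij jk ik a => -[] []. Qed.

Definition top_system : directed_system L bool :=
  DirectedSystem (inhabits true) top_trans_hom top_trans_filter top_trans_id
    top_trans_comp.

Definition top_val (S : set nat) (g : Fm L -> X) (psi : Fm L) :
    plonka_algebra top_system :=
  if `[< (Var psi `<=` S)%classic >] then existT top_fam false (g psi)
  else existT top_fam true e.

Lemma top_val_hom (S : set nat) (g : Fm L -> X) :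
  is_hom g -> is_hom (top_val S g).
Proof.
move=> hg o x; rewrite {1}/top_val.
case: asboolP => [/Var_FApp_subset sub|nsub].
  rewrite hg; symmetry; apply: (plonka_interp_fibre (D := top_system) (i := false)) => k.
  by rewrite !ffunE /top_val asboolT.
have [k nk] : exists k, ~ (Var (x k) `<=` S)%classic.
  by apply/existsNP => /Var_FApp_subset.
set y := [ffun k => _].
(* The argument [x k] has a variable outside [S], so it is sent to the top fibre; this forces the
   join to [true], where [e] is the only value. *)
have : (projT1 (y k) <= projT1 (plonka_interp y))%O.
  exact: (index_join_ub _ (fun k => projT1 (y k))).
rewrite {1}ffunE /top_val asboolF //.
change (interp y) with (plonka_interp y).
by case: (plonka_interp y) => -[] // t _; rewrite (T_e t).
Qed.

End TrivialTop.

Lemma left_companion_complete (L : language) (vd : logic L)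
    (M : lmatrix L -> Prop) Gamma phi :
  (exists T : lmatrix L, M T /\ is_trivial_matrix T) ->
  (forall Delta psi, matrix_entails M Delta psi -> vd Delta psi) ->
  matrix_entails (PL M) Gamma phi -> left_companion vd Gamma phi.
Proof.
move=> [T [MT [e T_e filt_e]]] compl Gphi.
(* The largest admissible set of premises: it is independent of [X] and [g], so one choice serves
   all valuations. *)
exists [set gamma | Gamma gamma /\ (Var gamma `<=` Var phi)%classic]%classic.
split=> [gamma []//|v [gamma [_ sub]] /sub//|].
apply: compl => X MX g hg gG.
pose D := top_system X T_e filt_e.
have MD i : M (D i) by case: i.
have := Gphi _ (PL_sum MD) _ (top_val_hom T_e filt_e (Var phi) hg).
rewrite {2}/top_val asboolT //=; apply=> _ [gamma Ggamma <-].
rewrite /top_val; case: asboolP => //= sub.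
by apply: gG; exists gamma.
Qed.

Theorem theorem3p7 (L : language) (vd : logic L) (M : lmatrix L -> Prop)
    (hM : exists X : lmatrix L, M X /\ is_trivial_matrix X)
    (hcomplete : complete_wrt vd M) :
  complete_wrt (left_companion vd) (PL M).
Proof.
move=> Gamma phi; split.
  by apply: left_companion_sound => Delta psi /hcomplete.
by apply: left_companion_complete => // Delta psi /hcomplete.
Qed.
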